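(* Let $A\in\mathbb{R}^{m\times n}$ be such that $Ae_j\neq cAe_i$ for all $i,j\in\{1,\dots,n\}$ with $i\neq j$ and all $c\in\mathbb{R}$. Let $P=A^\dagger A$ be the orthogonal projection onto $\mathcal{N}(A)^\perp$, and let $W\in\mathbb{R}^{n\times n}$ be the diagonal matrix with $We_i=\|Pe_i\|_2\,e_i$, $i=1,\dots,n$. Let $p,q\in\{1,\dots,n\}$ with $p\neq q$, and assume that there exist a constant $c\in\mathbb{R}$ and an index $j\in\{1,\dots,n\}$ such that $Ae_p+Ae_q=cAe_j$. Then $\|W(ce_j)\|_1<\|W(e_p+e_q)\|_1$, and $e_p+e_q$ is not a solution of $$\min_{x\in\mathbb{R}^n}\|Wx\|_1\quad\text{subject to}\quad Px=Pe_p+Pe_q.$$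
   Context: $e_1,\dots,e_n$ are the standard basis vectors of $\mathbb{R}^n$, $\|\cdot\|_1$ and $\|\cdot\|_2$ are the $\ell^1$- and Euclidean norms, $A^\dagger$ is the Moore-Penrose inverse of $A$, and $\mathcal{N}(A)$ is the null space of $A$. It is assumed, as part of the definition of $W$, that $Pe_i\neq 0$ for $i=1,\dots,n$. *)

(* Defs.v *)
From mathcomp Require Import all_boot all_order all_algebra.
From mathcomp Require Import reals.

Set Implicit Arguments.
Unset Strict Implicit.
Unset Printing Implicit Defensive.

Import Order.TTheory GRing.Theory Num.Theory.

Local Open Scope ring_scope.

Definition stdvec (R : rcfType) (n : nat) (i : 'I_n) : 'cV[R]_n :=
  delta_mx i 0.

Definition l1norm (R : rcfType) (n : nat) (x : 'cV[R]_n) : R :=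
  \sum_(i < n) `|x i 0|.

(* The norm of a matrix provided by the analysis library is the sup norm. *)
Definition l2norm (R : rcfType) (n : nat) (x : 'cV[R]_n) : R :=
  Num.sqrt (\sum_(i < n) x i 0 ^+ 2).

Definition moore_penrose (R : rcfType) (m n : nat)
    (A : 'M[R]_(m, n)) (X : 'M[R]_(n, m)) : bool :=
  [&& A *m X *m A == A, X *m A *m X == X,
      (A *m X)^T == A *m X & (X *m A)^T == X *m A].

Lemma gram_unitmx (R : rcfType) (r n : nat) (B : 'M[R]_(r, n)) :
  row_free B -> B *m B^T \in unitmx.
Proof.
move=> freeB; rewrite -row_free_unit; apply: inj_row_free => u uBB0.
have uB0 : u *m B = 0.
  have /matrixP/(_ 0 0) : (u *m B) *m (u *m B)^T = 0.
    by rewrite trmx_mul mulmxA -(mulmxA u) uBB0 mul0mx.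
  rewrite !mxE => /eqP; rewrite psumr_eq0; last first.
    by move=> i _; rewrite [in X in _ * X]mxE -expr2 sqr_ge0.
  move/allP => z; apply/rowP => i; have := z i (mem_index_enum i).
  by rewrite [in X in _ * X]mxE -expr2 sqrf_eq0 => /eqP ->; rewrite mxE.
by apply: (row_free_inj freeB); rewrite uB0 mul0mx.
Qed.

Lemma moore_penrose_exists (R : rcfType) (m n : nat) (A : 'M[R]_(m, n)) :
  exists X, moore_penrose A X.
Proof.
have : row_free (col_base A)^T.
  by rewrite /row_free mxrank_tr; exact: col_base_full.
have := row_base_free A; have := mulmx_base A.
move: (\rank A) (col_base A) (row_base A) => r C B defA freeB freeC.
pose G := B *m B^T; pose H := C^T *m C.
have uG : G \in unitmx by apply: gram_unitmx.
have uH : H \in unitmx by rewrite /H -{2}[C]trmxK; apply: gram_unitmx.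
have sG : (invmx G)^T = invmx G by rewrite trmx_inv trmx_mul trmxK.
have sH : (invmx H)^T = invmx H by rewrite trmx_inv trmx_mul trmxK.
pose X := B^T *m invmx G *m invmx H *m C^T.
have AX : A *m X = C *m invmx H *m C^T.
  by rewrite -defA /X !mulmxA -(mulmxA C B) -/G mulmxK.
have XA : X *m A = B^T *m invmx G *m B.
  by rewrite -defA /X !mulmxA -(mulmxA _ C^T C) -/H mulmxKV.
exists X; apply/and4P; split; apply/eqP.
- by rewrite AX -defA !mulmxA -(mulmxA _ C^T C) -/H mulmxKV.
- by rewrite XA /X !mulmxA -(mulmxA _ B B^T) -/G mulmxKV.
- by rewrite AX !trmx_mul trmxK sH mulmxA.
- by rewrite XA !trmx_mul trmxK sG mulmxA.
Qed.

Lemma moore_penrose_unique (R : rcfType) (m n : nat) (A : 'M[R]_(m, n)) X Y :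
  moore_penrose A X -> moore_penrose A Y -> X = Y.
Proof.
move=> /and4P[/eqP X1 /eqP X2 /eqP X3 /eqP X4].
move=> /and4P[/eqP Y1 /eqP Y2 /eqP Y3 /eqP Y4].
have AXY : A *m X = A *m Y.
  by rewrite -X3 -{1}Y1 -(mulmxA (A *m Y)) trmx_mul X3 Y3 mulmxA X1.
have XYA : X *m A = Y *m A.
  rewrite -X4 -{1}Y1 -(mulmxA A) mulmxA trmx_mul X4 Y4.
  by rewrite -!mulmxA (mulmxA A X) X1.
by rewrite -X2 XYA -mulmxA AXY mulmxA Y2.
Qed.

(* The Moore-Penrose inverse; pinvmx is only some partial inverse in general. *)
Definition dagger (R : rcfType) (m n : nat) (A : 'M[R]_(m, n)) : 'M[R]_(n, m) :=
  xchoose (moore_penrose_exists A).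

Lemma daggerP (R : rcfType) (m n : nat) (A : 'M[R]_(m, n)) :
  moore_penrose A (dagger A).
Proof. exact: xchooseP. Qed.

Definition is_minimizer (R : rcfType) (T : Type) (f : T -> R)
    (feasible : T -> Prop) (x : T) : Prop :=
  feasible x /\ forall y : T, feasible y -> f x <= f y.

(* Main.v *)
Require Import Defs.
From mathcomp Require Import all_boot all_order all_algebra.
From mathcomp Require Import reals.
From mathcomp Require Import ring.

Import Order.TTheory GRing.Theory Num.Theory.

Local Open Scope ring_scope.

(** Both claims come from strictness in the triangle inequality.  As [W] has
    diagonal entries [‖P e_i‖], the weighted objective satisfies
    [‖W (t e_i)‖₁ = |t| ‖P e_i‖ = ‖P (t e_i)‖]: on multiples of one basis vector
    it is the Euclidean norm of the projection, while on [e_p + e_q] it is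
    [‖P e_p‖ + ‖P e_q‖] (lemmas [l1norm_weighted_scale_stdvec] and
    [l1norm_weighted_add_stdvec]).  Applying the Moore-Penrose inverse of [A] to
    [A e_p + A e_q = c A e_j] gives [P e_p + P e_q = P (c e_j)], hence
    [‖W (c e_j)‖₁ = ‖P e_p + P e_q‖ ≤ ‖P e_p‖ + ‖P e_q‖ = ‖W (e_p + e_q)‖₁].
    Equality would make [P e_p] and [P e_q] parallel (lemma [ltr_l2normD]), and,
    because [A P = A], the columns [A e_p] and [A e_q] too, which the hypothesis
    on [A] excludes.  Since [c e_j] is feasible, [e_p + e_q] is not optimal. *)

Section EuclideanNorm.
Variables (R : rcfType) (n : nat).
Implicit Types u v : 'cV[R]_n.

Lemma sqr_l2norm u : l2norm u ^+ 2 = \sum_(i < n) u i 0 ^+ 2.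
Proof. by rewrite sqr_sqrtr // sumr_ge0 // => i _; apply: sqr_ge0. Qed.

Lemma l2norm_ge0 u : 0 <= l2norm u.
Proof. exact: sqrtr_ge0. Qed.

Lemma l2norm_gt0 u : u <> 0 -> 0 < l2norm u.
Proof.
move=> u0; rewrite lt_def l2norm_ge0 andbT -sqrf_eq0 sqr_l2norm.
apply/negP; rewrite psumr_eq0 => [/allP z|i _]; last exact: sqr_ge0.
apply: u0; apply/colP => i; rewrite mxE.
by apply/eqP; rewrite -sqrf_eq0; apply: z; apply: mem_index_enum.
Qed.

Lemma l2normZ a u : l2norm (a *: u) = `|a| * l2norm u.
Proof.
rewrite /l2norm -sqrtr_sqr -sqrtrM ?sqr_ge0 // mulr_sumr.
by congr Num.sqrt; apply: eq_bigr => i _; rewrite mxE exprMn.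
Qed.

Lemma sqr_l2norm_lincomb a b u v :
  l2norm (a *: u + b *: v) ^+ 2 =
  a ^+ 2 * l2norm u ^+ 2 + a * b * (\sum_(i < n) u i 0 * v i 0) *+ 2
  + b ^+ 2 * l2norm v ^+ 2.
Proof.
rewrite !sqr_l2norm !mulr_sumr -sumrMnl -!big_split /=.
by apply: eq_bigr => i _; rewrite !mxE; ring.
Qed.

(** The Cauchy-Schwarz inequality is strict by the identity
    [‖ ‖v‖ u - ‖u‖ v ‖² = 2 ‖u‖ ‖v‖ (‖u‖ ‖v‖ - ⟨u, v⟩)], whose left-hand side is
    nonzero when [u] is not a multiple of [v]; squaring then gives the
    triangle inequality. *)
Lemma ltr_l2normD u v : v <> 0 -> (forall k, u <> k *: v) ->
  l2norm (u + v) < l2norm u + l2norm v.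
Proof.
move=> v0 nuv; have u0 : u <> 0 by move=> u0; apply: (nuv 0); rewrite scale0r.
have nu0 := l2norm_gt0 u u0; have nv0 := l2norm_gt0 v v0.
have w0 : l2norm v *: u + (- l2norm u) *: v <> 0.
  move/eqP; rewrite scaleNr subr_eq0 => /eqP e.
  apply: (nuv ((l2norm v)^-1 * l2norm u)).
  by rewrite -scalerA -e scalerK // gt_eqF.
have := exprn_gt0 2 (l2norm_gt0 _ w0); rewrite sqr_l2norm_lincomb.
have := sqr_l2norm_lincomb 1 1 u v; rewrite !scale1r.
set d := \sum_(i < n) _ => eD lt0.
have ltd : d < l2norm u * l2norm v.
  rewrite -subr_gt0 -(pmulr_rgt0 _ (mulr_gt0 nu0 nv0)) -(pmulr_rgt0 _ (ltr0Sn R 1)).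
  by move: lt0; congr (0 < _); ring.
rewrite -(@ltr_pXn2r _ 2) // ?nnegrE ?addr_ge0 ?l2norm_ge0 // eD -subr_gt0.
have -> : (l2norm u + l2norm v) ^+ 2 -
    (1 ^+ 2 * l2norm u ^+ 2 + 1 * 1 * d *+ 2 + 1 ^+ 2 * l2norm v ^+ 2)
  = 2 * (l2norm u * l2norm v - d) by ring.
by rewrite pmulr_rgt0 ?ltr0Sn // subr_gt0.
Qed.

End EuclideanNorm.

Section WeightedNorm.
Variables (R : rcfType) (n : nat) (w : 'rV[R]_n).
Hypothesis w_ge0 : forall i, 0 <= w 0 i.

Lemma l1norm_weighted x :
  l1norm (diag_mx w *m x) = \sum_(i < n) w 0 i * `|x i 0|.
Proof.
by apply: eq_bigr => i _; rewrite mul_diag_mx mxE normrM ger0_norm.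
Qed.

Lemma l1norm_weighted_scale_stdvec c j :
  l1norm (diag_mx w *m (c *: stdvec R j)) = `|c| * w 0 j.
Proof.
rewrite l1norm_weighted (bigD1 j) //= big1 => [|i nij].
  by rewrite !mxE !eqxx mulr1 addr0 mulrC.
by rewrite !mxE (negPf nij) mulr0 normr0 mulr0.
Qed.

Lemma l1norm_weighted_add_stdvec p q : p != q ->
  l1norm (diag_mx w *m (stdvec R p + stdvec R q)) = w 0 p + w 0 q.
Proof.
move=> npq; rewrite l1norm_weighted (bigD1 p) //= (bigD1 q) 1?eq_sym //=.
rewrite big1 => [|i /andP[nip niq]].
  rewrite !mxE !eqxx (negPf npq) eq_sym (negPf npq) /=.
  by rewrite addr0 add0r normr1 !mulr1 addr0.
by rewrite !mxE (negPf nip) (negPf niq) addr0 normr0 mulr0.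
Qed.

End WeightedNorm.

Theorem mainTheorem4 (R : realType) (m n : nat) (A : 'M[R]_(m, n))
    (hA : forall i j : 'I_n, i <> j -> forall c : R,
        A *m stdvec R j <> c *: (A *m stdvec R i)) :
  let P : 'M[R]_n := dagger A *m A in
  let W : 'M[R]_n := diag_mx (\row_(i < n) l2norm (P *m stdvec R i)) in
  (forall i : 'I_n, P *m stdvec R i <> 0) ->
  forall p q : 'I_n, p <> q ->
  forall (c : R) (j : 'I_n),
    A *m stdvec R p + A *m stdvec R q = c *: (A *m stdvec R j) ->
    l1norm (W *m (c *: stdvec R j)) < l1norm (W *m (stdvec R p + stdvec R q)) /\
    ~ is_minimizer (fun x : 'cV[R]_n => l1norm (W *m x))
        (fun x : 'cV[R]_n => P *m x = P *m stdvec R p + P *m stdvec R q)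
        (stdvec R p + stdvec R q).
Proof.
move=> P W P0 p q npq c j Apq.
have AP x : A *m (P *m x) = A *m x.
  by have /and4P[/eqP e _ _ _] := daggerP A; rewrite /P !mulmxA e.
have feas : P *m (c *: stdvec R j) = P *m stdvec R p + P *m stdvec R q.
  by rewrite /P -!mulmxA -mulmxDr Apq -!scalemxAr.
have w0 i : 0 <= (\row_(i < n) l2norm (P *m stdvec R i)) 0 i.
  by rewrite mxE l2norm_ge0.
have lt : l1norm (W *m (c *: stdvec R j))
          < l1norm (W *m (stdvec R p + stdvec R q)).
  rewrite l1norm_weighted_scale_stdvec // l1norm_weighted_add_stdvec //; last first.
    exact/eqP.
  rewrite !mxE -l2normZ scalemxAr feas; apply: ltr_l2normD => // k ePk.
  apply: (hA q p (nesym npq) k).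
  by rewrite -AP ePk -scalemxAr AP.
by split=> // -[_ /(_ _ feas)]; rewrite leNgt lt.
Qed.
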